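(* Let $V_4$ be a space-time isometrically embedded in a real flat space $\mathcal{M}_D$ with orthonormal normal frame $\mathcal{N}_A$ ($A=5,\dots,D$) and twisting vector $A_{iAB}$. Under an infinitesimal pseudo-rotation of the normal vectors with parameters $\Theta^{MN}=\Theta^{MN}(x^i)$ (that is, to first order in $\Theta$), the twisting vector transforms as $$A'_{iAB}=A_{iAB}-f^{EF}_{AB\,MN}\,A_{iEF}\,\Theta^{MN}-\Theta_{AB,i},$$ where $f^{EF}_{AB\,MN}$ are the structure constants of the group $SO(p-3,q-1)$ of pseudo-rotations of the normal vectors, for an appropriate choice of the normalization constant $\alpha$ of its generators.
   Context: $V_4$ is a 4-dimensional manifold with coordinates $x^i$ and Lorentzian metric $g_{ij}$; $\mathcal{M}_D$ is flat with Cartesian metric $\eta_{\mu\nu}$ of signature $(p,q)$, $p+q=D$. Lower case Latin indices run over $1,\dots,4$, capital Latin over $5,\dots,D$, Greek over $1,\dots,D$. The embedding $\mathcal{Y}:V_4\to\mathcal{M}_D$ satisfies $g_{ij}=\mathcal{Y}^{\mu}{}_{,i}\mathcal{Y}^{\nu}{}_{,j}\eta_{\mu\nu}$, and the normal vectors satisfy $\mathcal{N}^{\mu}_A\mathcal{Y}^{\nu}{}_{,i}\eta_{\mu\nu}=0$, $\mathcal{N}^{\mu}_A\mathcal{N}^{\nu}_B\eta_{\mu\nu}=g_{AB}=\epsilon_A\delta_{AB}$, $\epsilon_A=\pm1$. Capital indices are raised and lowered with $g^{AB}$ and $g_{AB}$. One time-like direction is tangent to $V_4$, so the group of pseudo-rotations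 of the normal vectors is $SO(p-3,q-1)$. The twisting vector is $A_{iAB}=\mathcal{N}^{\mu}{}_{A}\,\mathcal{N}^{\nu}{}_{B,i}\,\eta_{\mu\nu}$, which is antisymmetric in $A,B$. Near $V_4$ one uses the coordinates $(x^i,x^A)$ of $\mathcal{M}_D$ given by $\mathcal{Z}^{\mu}(x^i,x^A)=\mathcal{Y}^{\mu}(x^i)+x^A\mathcal{N}^{\mu}_A(x^i)$. An infinitesimal pseudo-rotation is the transformation $x'^i=x^i$, $x'^A=x^A+\Theta^A{}_M(x^i)\,x^M$, where $\Theta_{AB}=g_{AM}\Theta^M{}_B$ is antisymmetric and only first-order terms in $\Theta$ are kept; the rotated normal vectors $\mathcal{N}'_A$ are those for which $x^A\mathcal{N}_A=x'^A\mathcal{N}'_A$ to first order, and $A'_{iAB}$ is the twisting vector of the frame $\mathcal{N}'_A$. The generators $L^{AB}=-L^{BA}$ of the Lie algebra satisfy $[L^{MN},L^{PQ}]=f^{MNPQ}_{AB}L^{AB}$ with $$f^{MNPQ}_{AB}=4\alpha\,\delta_A^{[N}g^{M][P}\delta_B^{Q]},\qquad f^{PQ}_{AB\,MN}=4\alpha\,\delta^{P}_{[A}\,g_{B][M}\,\delta^{Q}_{N]},$$ where $\alpha$ is a nonzero real normalization constant and square brackets denote antisymmetrization with weight $1/2$ over the pair of indices next to the brackets. *)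

(* Defs.v *)
From HB Require Import structures.
From mathcomp Require Import all_boot all_order all_algebra.
From mathcomp Require Import all_classical all_reals all_analysis.

Set Implicit Arguments.
Unset Strict Implicit.
Unset Printing Implicit Defensive.
Import Order.TTheory GRing.Theory Num.Theory.
Import numFieldNormedType.Exports.

Local Open Scope classical_set_scope.
Local Open Scope ring_scope.

(* V_4 is given by the range U of its coordinates x^i, a nonempty open set of
   'rV[R]_4.  Fields are functions of these coordinates.  Indices start at 0:
   i : 'I_4, Greek indices in 'I_D, capital Latin indices in 'I_n, n = D - 4. *)

Definition partial (R : realType) (i : 'I_4) (f : 'rV[R]_4 -> R) (x : 'rV[R]_4) : R :=
  'D_(delta_mx 0 i) f x.

Section Metrics.
Variable R : realType.

(* Signature (p, q): p space-like (+1) and q time-like (-1) directions. *)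
Definition sign_vector m (d : 'rV[R]_m) (p q : nat) : Prop :=
  [/\ forall k, d 0 k = 1 \/ d 0 k = -1,
      #|[set k | d 0 k == 1]%SET| = p
    & #|[set k | d 0 k == -1]%SET| = q].

Definition has_signature m (G : 'M[R]_m) (p q : nat) : Prop :=
  exists (P : 'M[R]_m) (d : 'rV[R]_m),
    [/\ P \in unitmx, sign_vector d p q & P^T *m G *m P = diag_mx d].

Definition dot m (G : 'M[R]_m) (u v : 'I_m -> R) : R :=
  \sum_mu \sum_nu u mu * v nu * G mu nu.

(* Lie algebra of the group SO(G).  The matrix X has entries X^A_M (row A, column M); with lowered upper index
   it is G *m X. *)
Definition in_so m (G X : 'M[R]_m) : Prop := (G *m X)^T = - (G *m X).

End Metrics.

Section Embedding.
Variables (R : realType) (D n : nat).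
Variables (U : set 'rV[R]_4) (eta : 'M[R]_D).

(* x |-> Y^mu(x) *)
Definition embedding := 'I_D -> 'rV[R]_4 -> R.
(* x |-> N^mu_A(x), written N A mu x *)
Definition frame := 'I_n -> 'I_D -> 'rV[R]_4 -> R.

Definition isometric_embedding (g : 'rV[R]_4 -> 'M[R]_4) (Y : embedding) : Prop :=
  forall x, U x ->
    (forall mu, differentiable (Y mu) x) /\
    (forall i j, g x i j = dot eta (fun mu => partial i (Y mu) x)
                                   (fun mu => partial j (Y mu) x)).

Definition orthonormal_normal_frame (Y : embedding) (gN : 'M[R]_n) (N : frame) : Prop :=
  forall x, U x ->
    [/\ forall A mu, differentiable (N A mu) x,
        forall A i, dot eta (fun mu => N A mu x) (fun mu => partial i (Y mu) x) = 0
      & forall A B, dot eta (fun mu => N A mu x) (fun mu => N B mu x) = gN A B].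

Definition twisting (N : frame) (i : 'I_4) (A B : 'I_n) (x : 'rV[R]_4) : R :=
  dot eta (fun mu => N A mu x) (fun mu => partial i (N B mu) x).

(* Equality to first order in the parameter s -> 0 of two families of fields.
   The twisting vector contains x-derivatives, so the first-order
   approximation is required for the fields and for their partial derivatives. *)
Definition eq_first_order (F G : R -> 'rV[R]_4 -> R) : Prop :=
  forall x, U x ->
    (fun s => F s x - G s x) =o_ (0 : R) id /\
    forall i, (fun s => partial i (F s) x - partial i (G s) x) =o_ (0 : R) id.

(* Pseudo-rotations x'^A = x^A + Theta^A_M x^M with Theta antisymmetric once
   lowered; Theta x A M is Theta^A_M(x). *)
Definition rotation_parameter (gN : 'M[R]_n) (Theta : 'rV[R]_4 -> 'M[R]_n) : Prop :=
  forall x, U x ->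
    in_so gN (Theta x) /\ (forall A M, differentiable (fun y => Theta y A M) x).

Definition rotate (Theta : 'M[R]_n) (xi : 'I_n -> R) (A : 'I_n) : R :=
  xi A + \sum_M Theta A M * xi M.

(* x^A N_A *)
Definition displacement (N : frame) (xi : 'rV[R]_4 -> 'I_n -> R) (mu : 'I_D)
    (x : 'rV[R]_4) : R :=
  \sum_A xi x A * N A mu x.

(* The infinitesimal parameter is s *: Theta with s -> 0, and N' s is the
   frame rotated by it: x^A N_A = x'^A N'_A to first order, for all x^A. *)
Definition rotated_frame (N : frame) (Theta : 'rV[R]_4 -> 'M[R]_n)
    (N' : R -> frame) : Prop :=
  (forall x, U x -> \forall s \near (0 : R),
     forall A mu, differentiable (N' s A mu) x) /\
  forall (xi : 'I_n -> R) (mu : 'I_D),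
    eq_first_order (fun s => displacement N (fun=> xi) mu)
      (fun s => displacement (N' s) (fun x => rotate (s *: Theta x) xi) mu).

End Embedding.

Section StructureConstants.
Variables (R : realType) (n : nat).
Variables (alpha : R) (gN : 'M[R]_n).
Local Notation I := 'I_n.
Local Notation gNinv := (invmx gN).
Local Notation delta A B := ((A == B)%:R : R).

Definition asym (F : I -> I -> R) (A B : I) : R := (F A B - F B A) / 2.

(* Theta_{AB} and Theta^{MN} from Theta^A_M *)
Definition lower (X : 'M[R]_n) : 'M[R]_n := gN *m X.
Definition raise (X : 'M[R]_n) : 'M[R]_n := X *m gNinv.

(* f^{MNPQ}_{AB} = 4 alpha delta_A^{[N} g^{M][P} delta_B^{Q]} *)
Definition f_up (M N P Q A B : I) : R :=
  4 * alpha *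
  asym (fun N M => asym (fun P Q => delta A N * gNinv M P * delta B Q) P Q) N M.

(* f^{PQ}_{AB MN} = 4 alpha delta^P_{[A} g_{B][M} delta^Q_{N]} *)
Definition f_mixed (P Q A B M N : I) : R :=
  4 * alpha *
  asym (fun A B => asym (fun M N => delta P A * gN B M * delta Q N) M N) A B.

Definition commutator (X Y : 'M[R]_n) : 'M[R]_n := X *m Y - Y *m X.

Definition lower_generators (L : I -> I -> 'M[R]_n) (M N : I) : 'M[R]_n :=
  \sum_P \sum_Q (gN M P * gN N Q) *: L P Q.

(* f_up and f_mixed are the structure constants of so(gN) with respect to
   generators L^{AB} = - L^{BA} normalized by alpha; the L^{AB} with A < B form
   a basis, expressed by unique expansion with antisymmetric coefficients.
   f^{EF}_{AB MN} is not antisymmetric in EF as it stands (nor is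
   f^{MNPQ}_{AB} in AB), but it is only ever contracted with antisymmetric
   objects; hence the antisymmetrization over EF in the last clause, which
   says [L^{EF}, L_{MN}] = f^{[EF]}_{AB MN} L^{AB}. *)
Definition so_structure_constants : Prop :=
  exists L : I -> I -> 'M[R]_n,
  [/\ (forall A B, L A B = - L B A) /\ (forall A B, in_so gN (L A B)),
      forall X, in_so gN X ->
        exists! c : 'M[R]_n, c^T = - c /\ X = \sum_A \sum_B c A B *: L A B,
      forall M N P Q, commutator (L M N) (L P Q) =
        \sum_A \sum_B f_up M N P Q A B *: L A B
    & forall E F M N, commutator (L E F) (lower_generators L M N) =
        \sum_A \sum_B asym (fun E F => f_mixed E F A B M N) E F *: L A B].

End StructureConstants.

(* Main.v *)
(* At a point of V_4 the tangent vectors, put in diagonal form, and the normal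
   vectors form a family of p + q vectors on which eta restricts to a diagonal
   form; Sylvester's inertia argument bounds the number of its positive and
   negative entries by p and q, and the totals agree.  With the upper index
   lowered, L^{AB} is a multiple of the elementary antisymmetric matrix
   E_{AB} - E_{BA}, which gives the structure constants.

   f = o(s) means f(0) = 0 and f'(0) = 0, so the transformation law is a
   computation of derivatives at s = 0.  The rotated frame is only given
   implicitly, by N'_A + s Theta^C_A N'_C = N_A + o(s); solving this gives
   dN'_A/ds = - Theta^C_A N_C, and similarly for the partial derivatives, whence
   dA'_{iAB}/ds = - Theta^C_A A_{iCB} - Theta^C_B A_{iAC} - Theta_{AB,i}.  The
   first two terms are the contraction with f when alpha = -1/2. *)

Require Import Defs.
From mathcomp Require Import all_boot all_order all_algebra.
From mathcomp Require Import all_classical all_reals all_analysis.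
From mathcomp Require Import ring lra zify.
Import Order.TTheory GRing.Theory Num.Theory.
Import numFieldNormedType.Exports.
Local Open Scope classical_set_scope.
Local Open Scope ring_scope.
Set Implicit Arguments.
Unset Strict Implicit.
Unset Printing Implicit Defensive.

(** * Inertia *)

(* The rows of [B] where [e = t] stay independent after projection to the
   coordinates where [d = t]: on a combination that projects to [0], [t] times
   the form is [<= 0] by [d] and equals the sum of squared coefficients by [e]. *)
Lemma congruent_diag_card_le (R : realType) m n (t : R)
    (d : 'rV[R]_m) (e : 'rV[R]_n) (B : 'M[R]_(n, m)) :
  t = 1 \/ t = -1 ->
  (forall k, d 0 k = 1 \/ d 0 k = -1) ->
  B *m diag_mx d *m B^T = diag_mx e ->
  (#|[set k | (e 0 k == t)%R]%SET| <= #|[set k | (d 0 k == t)%R]%SET|)%N.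
Proof.
move=> ht hd BE.
set J := [set k | (e 0 k == t)%R]%SET; set K := [set k | (d 0 k == t)%R]%SET.
have tt : t * t = 1 by case: ht => ->; rewrite ?mulrNN mulr1.
(* [M] keeps the rows of [B] indexed by [J] and the columns indexed by [K]; if its rows are
   independent, its rank [#|J|] is at most [#|K|]. *)
pose M : 'M[R]_(#|J|, #|K|) := \matrix_(a, b) B (enum_val a) (enum_val b).
suff /eqP <- : row_free M by exact: rank_leq_col.
apply: inj_row_free => v vM.
(* [c] extends the coefficients [v] by zero outside [J], so that [w] below is the full row
   combination whose [K]-coordinates [vM] kills. *)
pose c : 'rV[R]_n := \row_k \sum_(a | enum_val a == k) v 0 a.
have cJ a : c 0 (enum_val a) = v 0 a.
  rewrite mxE (big_pred1 a)// => b /=.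
  by rewrite (inj_eq enum_val_inj).
have cNJ k : k \notin J -> c 0 k = 0.
  move=> kJ; rewrite mxE big_pred0// => a.
  by apply: contraNF kJ => /eqP <-; exact: enum_valP.
pose w := c *m B.
have wK k : k \in K -> w 0 k = 0.
  move=> kK; have /matrixP/(_ 0 (enum_rank_in kK k)) := vM.
  rewrite mxE [X in _ = X]mxE => vMk; rewrite /w mxE (bigID (mem J)) /=.
  rewrite [X in _ + X]big1 ?addr0 => [|j /cNJ ->]; last by rewrite mul0r.
  rewrite big_enum_val /= -[RHS]vMk; apply: eq_bigr => a _.
  by rewrite cJ mxE enum_rankK_in.
have quad r (u f : 'rV[R]_r) :
    (u *m diag_mx f *m u^T) 0 0 = \sum_k f 0 k * u 0 k ^+ 2.
  rewrite mul_mx_diag mxE; apply: eq_bigr => k _.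
  by rewrite !mxE expr2 mulrCA mulrA.
have wc : w *m diag_mx d *m w^T = c *m diag_mx e *m c^T.
  by rewrite /w trmx_mul -BE !mulmxA.
have := quad _ w d; rewrite wc quad => /(congr1 ( *%R t)); rewrite !mulr_sumr => E.
have dN k : t * (d 0 k * w 0 k ^+ 2) = - w 0 k ^+ 2.
  have [kK|] := boolP (k \in K); first by rewrite wK// expr0n/= !mulr0 oppr0.
  by rewrite inE; case: ht (hd k) => -> [] ->; rewrite ?eqxx//; lra.
have eN k : t * (e 0 k * c 0 k ^+ 2) = c 0 k ^+ 2.
  have [|kK] := boolP (k \in J); last by rewrite cNJ// expr0n/= !mulr0.
  by rewrite inE => /eqP ->; rewrite mulrA tt mul1r.
rewrite (eq_bigr _ (fun k _ => dN k)) (eq_bigr _ (fun k _ => eN k)) sumrN in E.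
(* [E] now equates a sum of squares with minus a sum of squares, so both vanish. *)
have : \sum_k c 0 k ^+ 2 == 0.
  rewrite eq_le; apply/andP; split; last by apply: sumr_ge0 => k _; exact: sqr_ge0.
  by rewrite E oppr_le0; apply: sumr_ge0 => k _; exact: sqr_ge0.
rewrite psumr_eq0; last by move=> k _; exact: sqr_ge0.
move=> /allP c0; apply/rowP => a; rewrite -cJ [RHS]mxE.
have := c0 (enum_val a); rewrite mem_index_enum sqrf_eq0 => /(_ isT)/eqP; exact.
Qed.

Lemma card_row_mx_eq (R : realType) m n (a : 'rV[R]_m) (b : 'rV[R]_n) (t : R) :
  #|[set k | (row_mx a b 0 k == t)%R]%SET| =
  (#|[set k | (a 0 k == t)%R]%SET| + #|[set k | (b 0 k == t)%R]%SET|)%N.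
Proof.
rewrite !cardsE -!sum1_card big_mkcond big_split_ord /= -!big_mkcond /=.
by congr (_ + _)%N; apply: eq_bigl => k; rewrite !unfold_in ?row_mxEl ?row_mxEr.
Qed.

Lemma card_sign_vector (R : realType) n (e : 'rV[R]_n) :
  (forall k, e 0 k = 1 \/ e 0 k = -1) ->
  (#|[set k | (e 0 k == 1)%R]%SET| + #|[set k | (e 0 k == -1)%R]%SET|)%N = n.
Proof.
move=> he; rewrite -[RHS]card_ord -(cardsC [set k | (e 0 k == 1)%R]%SET).
congr (_ + _)%N; apply: eq_card => k; rewrite !inE.
have n11 : (-1 == 1 :> R) = false by apply/eqP; lra.
by case: (he k) => ->; rewrite ?eqxx ?n11 // eq_sym n11.
Qed.

(** Inertia for both signs gives a + 3 <= p and b + 1 <= q, where a and b count the entries 1 and -1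
    of [e]. Since a + b = p + q - 4, both are equalities; the lower bounds on p and q make the
    truncated subtractions genuine. *)
Lemma complement_signature (R : realType) p q (d : 'rV[R]_(p + q))
    (e : 'rV[R]_(p + q - 4)) (f : 'rV[R]_4)
    (B : 'M[R]_(4 + (p + q - 4), p + q)) :
  (3 <= p)%N -> (1 <= q)%N -> sign_vector d p q -> sign_vector f 3 1 ->
  (forall k, e 0 k = 1 \/ e 0 k = -1) ->
  B *m diag_mx d *m B^T = diag_mx (row_mx f e) ->
  sign_vector e (p - 3) (q - 1).
Proof.
move=> hp hq [hd dp dq] [_ fp fq] he BE.
have := congruent_diag_card_le (or_introl erefl) hd BE.
have := congruent_diag_card_le (or_intror erefl) hd BE.
rewrite !card_row_mx_eq fp fq dp dq.
have := card_sign_vector he.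
set a := #|_|; set b := #|_| => ab hb ha.
by split=> //; rewrite -/a -/b; lia.
Qed.

(** * Structure constants *)

Section StructureConstantsOfSo.
Variables (R : realType) (n : nat) (alpha : R) (eps : 'rV[R]_n).
Hypothesis eps2 : forall k, eps 0 k * eps 0 k = 1.
Local Notation gN := (diag_mx eps).
Local Notation delta A B := ((A == B)%:R : R).

Lemma diag_mx_involutive : gN *m gN = 1%:M.
Proof.
apply/matrixP => i j; rewrite mul_diag_mx !mxE; case: eqP => [->|_].
  by rewrite mulr1n eps2.
by rewrite mulr0.
Qed.

Lemma invmx_diag_sign : invmx gN = gN.
Proof.
have [gu _] := mulmx1_unit diag_mx_involutive.
by rewrite -[LHS]mulmx1 -diag_mx_involutive mulmxA mulVmx// mul1mx.
Qed.

Lemma diag_mxE A B : gN A B = eps 0 B * delta A B.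
Proof. by rewrite mxE mulr_natr; case: eqP => // ->. Qed.

Lemma sum_delta_scale (V : lmodType R) (L : 'I_n -> 'I_n -> V) (k : R) a b :
  \sum_A \sum_B (k * delta A a * delta B b) *: L A B = k *: L a b.
Proof.
rewrite (bigD1 a)//= [X in _ + X]big1 ?addr0 => [|A /negPf Aa]; last first.
  by apply: big1 => B _; rewrite Aa mulr0 mul0r scale0r.
rewrite (bigD1 b)//= [X in _ + X]big1 ?addr0 => [|B /negPf Bb].
  by rewrite !eqxx !mulr1.
by rewrite Bb mulr0 scale0r.
Qed.

(** The factor 4 cancels the two weights 1/2, and in each of the four terms of the double
    antisymmetrization the deltas select one member of [L]. *)
Lemma sum_f_up (V : lmodType R) (L : 'I_n -> 'I_n -> V) M N P Q :
  \sum_A \sum_B f_up alpha gN M N P Q A B *: L A B =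
  alpha *: (gN M P *: L N Q - gN M Q *: L N P
            - gN N P *: L M Q + gN N Q *: L M P).
Proof.
rewrite !(scalerDr, scalerN) !scalerA -!sum_delta_scale.
rewrite -!(sumrB, big_split) /=; apply: eq_bigr => A _.
rewrite -!(sumrB, big_split) /=; apply: eq_bigr => B _.
rewrite -!scalerBl -scalerDl; congr (_ *: _).
by rewrite /f_up /asym invmx_diag_sign; field.
Qed.

Lemma sum_f_mixed (V : lmodType R) (L : 'I_n -> 'I_n -> V) E F M N :
  \sum_A \sum_B f_mixed alpha gN E F A B M N *: L A B =
  alpha *: ((eps 0 M * delta F N) *: (L E M - L M E)
            - (eps 0 N * delta F M) *: (L E N - L N E)).
Proof.
rewrite !(scalerDr, scalerN) !scalerA opprB addrA -!sum_delta_scale.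
rewrite -!(sumrB, big_split) /=; apply: eq_bigr => A _.
rewrite -!(sumrB, big_split) /=; apply: eq_bigr => B _.
rewrite -!(scalerBl, scalerDl); congr (_ *: _).
rewrite /f_mixed /asym !diag_mxE ![E == _]eq_sym; by field.
Qed.

(** The factor [gN] raises the first index of the elementary antisymmetric matrix. The scalar
    [- alpha] is chosen so that the commutator, which is quadratic in it, is [alpha] times a
    combination of generators. *)
Definition so_generator (A B : 'I_n) : 'M[R]_n :=
  - alpha *: (gN *m (delta_mx A B - delta_mx B A)).

Lemma so_generatorN A B : so_generator A B = - so_generator B A.
Proof. by rewrite /so_generator -scalerN -mulmxN opprB. Qed.

Lemma so_generator_in_so A B : in_so gN (so_generator A B).
Proof.
rewrite /in_so /so_generator -scalemxAr mulmxA diag_mx_involutive mul1mx.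
by rewrite linearZ /= linearB /= !trmx_delta -scalerN opprB.
Qed.

Lemma sum_so_generator (c : 'M[R]_n) :
  \sum_A \sum_B c A B *: so_generator A B = - alpha *: (gN *m (c - c^T)).
Proof.
transitivity (- alpha *: (gN *m \sum_A \sum_B c A B *: (delta_mx A B - delta_mx B A))).
  rewrite mulmx_sumr scaler_sumr; apply: eq_bigr => A _.
  rewrite mulmx_sumr scaler_sumr; apply: eq_bigr => B _.
  by rewrite /so_generator -scalemxAr !scalerA mulrC.
congr (_ *: (_ *m _)).
rewrite [in RHS](matrix_sum_delta c) [_^T]linear_sum /= -sumrB; apply: eq_bigr => A _.
rewrite [_^T]linear_sum /= -sumrB; apply: eq_bigr => B _.
by rewrite linearZ /= trmx_delta scalerBr.
Qed.

(** The factor 2 appears because the double sum meets each unordered pair of indices twice. *)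
Lemma sum_so_generator_antisym (c : 'M[R]_n) : c^T = - c ->
  \sum_A \sum_B c A B *: so_generator A B = (-2 * alpha) *: (gN *m c).
Proof.
move=> cT; rewrite sum_so_generator cT opprK mulmxDr -mulr2n -(scaler_nat 2).
by rewrite scalerA; congr (_ *: _); ring.
Qed.

Lemma so_generator_commutator M N P Q :
  commutator (so_generator M N) (so_generator P Q) =
  alpha *: (gN M P *: so_generator N Q - gN M Q *: so_generator N P
            - gN N P *: so_generator M Q + gN N Q *: so_generator M P).
Proof.
(* The commutator reduces to contractions of elementary matrices through the metric; what remains is
   a linear identity between their entries. *)
have dgd A B C D : delta_mx A B *m gN *m delta_mx C D = gN B C *: delta_mx A D.
  apply/matrixP => i j; rewrite mul_mx_diag !mxE (bigD1 B)//= big1 => [|k /negPf kB].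
    rewrite !mxE !eqxx addr0 andbT.
    by case: (_ == A); case: (j == D); case: (B =P C) => [->|_];
      rewrite ?andbF ?andbT /=; ring.
  by rewrite !mxE kB andbF !mul0r.
have gC A B : gN A B = gN B A by rewrite !mxE eq_sym; case: eqP => // ->.
rewrite /commutator /so_generator -!scalemxAl -!scalemxAr !scalerA -!mulmxA.
rewrite -scalerBr -mulmxBr.
rewrite !scalemxAr -!mulmxBr -!mulmxDr !scalemxAr; congr (_ *m _).
rewrite !mulmxBl !mulmxBr !mulmxA !dgd.
rewrite (gC P M) (gC P N) (gC Q M) (gC Q N).
by apply/matrixP => i j; rewrite !mxE; ring.
Qed.

Lemma lower_so_generator M N :
  lower_generators gN so_generator M N = (eps 0 M * eps 0 N) *: so_generator M N.
Proof.
rewrite -sum_delta_scale /lower_generators; apply: eq_bigr => A _.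
apply: eq_bigr => B _; congr (_ *: _); rewrite !diag_mxE.
by rewrite (eq_sym M) (eq_sym N); do 2 (case: eqP => [->|_] /=); ring.
Qed.

Lemma so_structure_constants_diag :
  alpha != 0 -> so_structure_constants alpha gN.
Proof.
move=> a0; exists so_generator; split.
- by split; [exact: so_generatorN|exact: so_generator_in_so].
(* The coefficients come from inverting [sum_so_generator_antisym], [gN] being its own inverse; the
   same inversion gives uniqueness. *)
- move=> X soX; exists ((- 2 * alpha)^-1 *: (gN *m X)); split.
    have cT : ((- 2 * alpha)^-1 *: (gN *m X))^T = - ((- 2 * alpha)^-1 *: (gN *m X)).
      by rewrite linearZ /= soX scalerN.
    split=> //; rewrite (sum_so_generator_antisym cT).
    rewrite -!scalemxAr !scalerA mulmxA diag_mx_involutive mul1mx.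
    by rewrite [Z in Z *: _](_ : _ = 1) ?scale1r//; field.
  move=> c [cT ->]; rewrite (sum_so_generator_antisym cT).
  rewrite -!scalemxAr !scalerA mulmxA diag_mx_involutive mul1mx.
  by rewrite [Z in Z *: _](_ : _ = 1) ?scale1r//; field.
- by move=> M N P Q; rewrite sum_f_up so_generator_commutator.
- move=> E F M N.
  (* The antisymmetrization over E, F is moved outside the sum, so that [sum_f_mixed] applies to
     each half. *)
  transitivity (2^-1 *: (\sum_A \sum_B f_mixed alpha gN E F A B M N *: so_generator A B
     - \sum_A \sum_B f_mixed alpha gN F E A B M N *: so_generator A B)); last first.
    rewrite -sumrB scaler_sumr; apply: eq_bigr => A _.
    rewrite -sumrB scaler_sumr; apply: eq_bigr => B _.
    by rewrite -scalerBl scalerA /asym mulrC.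
  rewrite lower_so_generator /commutator -scalemxAr -scalemxAl -scalerBr.
  rewrite -[_ - _ in LHS]/(commutator _ _) so_generator_commutator !sum_f_mixed.
  rewrite (so_generatorN M E) (so_generatorN M F).
  rewrite (so_generatorN N E) (so_generatorN N F).
  rewrite !diag_mxE.
  move: (so_generator _ _) (so_generator _ _) (so_generator _ _) (so_generator _ _).
  move=> W X Y Z; apply/matrixP => i j; rewrite !mxE.
  (* Lowering contributes the signs of M and N, and the metric in the commutator repeats one of
     them; the squares are isolated so that [eps2] removes them. *)
  transitivity (alpha *
    ((eps 0 M * eps 0 M) * eps 0 N * ((E == M)%:R * Z i j - (F == M)%:R * X i j)
     + (eps 0 N * eps 0 N) * eps 0 M * ((F == N)%:R * W i j - (E == N)%:R * Y i j))).
    by ring.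
  by rewrite !eps2; field.
Qed.

End StructureConstantsOfSo.

(** * First-order expansions *)

(** Evaluating the bound at s = 0 forces f(0) = 0, after which f(s)/s is the difference quotient.
    First-order equalities thereby become statements about derivatives at 0. *)
Lemma littleo_id_is_derive (R : realType) (f : R -> R) :
  (f =o_ (0 : R) id) <-> f 0 = 0 /\ is_derive (0 : R) (1 : R) f 0.
Proof.
split=> [/eqoP fo|[f0 df]].
- have f0 : f 0 = 0.
    have /nbhs_singleton /= := fo 1 ltr01.
    by rewrite normr0 mulr0 normr_le0 => /eqP.
  have cf : h^-1 *: (f (h *: (1 : R) + 0) - f 0) @[h --> (0 : R)^'] --> (0 : R).
    apply/cvgrPdist_le => e e0.
    have := fo e e0; rewrite /= => foe; near=> h.
    have h0 : h != 0 by near: h; exact: nbhs_dnbhs_neq.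
    rewrite sub0r normrN f0 subr0 addr0 [h *: _]mulr1 normrZ normfV.
    rewrite mulrC ler_pdivrMr ?normr_gt0//.
    near: h; exact: nbhs_dnbhs.
  split=> //; apply: DeriveDef; first by apply/cvg_ex; exists 0.
  exact: cvg_lim cf.
- have /derivable_nbhs : derivable f 0 1 by [].
  rewrite derive_val f0 => /eqaddoP H.
  apply/eqoP => e e0; have := H e e0; rewrite /=.
  apply: filterS => h /=.
  by rewrite !fctE /= addr0 [h *: 1]mulr1 scaler0 addr0 subr0.
Unshelve. all: by end_near.
Qed.

(** The difference quotient at 0 is f(h) itself, so continuity of f does the work where the product
    rule would ask for a derivative. *)
Lemma is_derive0_idM (R : realType) (f : R -> R) :
  {for 0, continuous f} -> is_derive (0 : R) (1 : R) (fun s => s * f s) (f 0).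
Proof.
move=> cf.
have H : h^-1 *: ((h *: (1 : R) + 0) * f (h *: (1 : R) + 0) - 0 * f 0)
    @[h --> (0 : R)^'] --> f 0.
  apply: (@cvg_trans _ (f h @[h --> (0:R)^'])); last exact: cvg_within_filter cf.
  apply: near_eq_cvg; near=> h.
  have h0 : h != 0 by near: h; exact: nbhs_dnbhs_neq.
  by rewrite mul0r subr0 addr0 [h *: 1]mulr1 [_ *: _]mulrA mulVf// mul1r.
apply: DeriveDef; first by apply/cvg_ex; exists (f 0).
exact: cvg_lim H.
Unshelve. all: by end_near.
Qed.

Lemma near0_norm_le (R : realType) (e : R) :
  0 < e -> \forall s \near (0 : R), `|s| <= e.
Proof. by move=> e0; apply: filterS (nbhs0_le e0) => s. Qed.

Lemma is_derive0_continuous (R : realType) (f : R -> R) (df : R) :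
  is_derive (0 : R) (1 : R) f df -> {for 0, continuous f}.
Proof.
move=> df0; apply: differentiable_continuous; apply/derivable1_diffP.
exact: ex_derive.
Qed.

(* The implicit relation bounds [F] near [0], so [s * F C s] is [o(1)] and [F]
   is continuous at [0]; then [s * F C s] has derivative [F C 0] there. *)
Lemma is_derive0_implicit (R : realType) n (K : 'I_n -> 'I_n -> R)
    (F : 'I_n -> R -> R) (dG : 'I_n -> R) :
  (forall A, is_derive (0 : R) (1 : R)
     (fun s => F A s + s * \sum_C K C A * F C s) (dG A)) ->
  forall A, is_derive (0 : R) (1 : R) (F A) (dG A - \sum_C K C A * F C 0).
Proof.
move=> HG; set G := fun A s => F A s + s * \sum_C K C A * F C s.
have cG A : {for 0, continuous (G A)} := is_derive0_continuous (HG A).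
have FE A s : F A s = G A s - s * \sum_C K C A * F C s by rewrite /G addrK.
(* [S] is the l1 norm of the unknowns and [kappa] the total size of the coefficients. *)
pose kappa := \sum_A \sum_C `|K C A|; pose S s := \sum_C `|F C s|.
have kappa0 : 0 <= kappa by apply: sumr_ge0 => ? _; apply: sumr_ge0.
have sumKF s A : `|\sum_C K C A * F C s| <= kappa * S s.
  apply: (le_trans (ler_norm_sum _ _ _)); rewrite mulr_sumr.
  apply: ler_sum => C _; rewrite normrM; apply: ler_wpM2r => //.
  rewrite /kappa (bigD1 A)//= (bigD1 C)//= -addrA lerDl addr_ge0//.
    exact: sumr_ge0.
  by apply: sumr_ge0 => ? _; apply: sumr_ge0.
(* For small s the relation gives S <= M / 2 + S / 2, hence S <= M. *)
pose M := 2 * \sum_A (1 + `|G A 0|).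
have bS : \forall s \near (0 : R), S s <= M.
  have nG : \forall s \near (0 : R), forall A, `|G A s| <= 1 + `|G A 0|.
    apply: (@filter_forall R 'I_n (fun A s => `|G A s| <= 1 + `|G A 0|)
      (nbhs (0 : R)) _) => A.
    have /cvgr_norm_le : G A s @[s --> (0 : R)] --> G A 0 := cG A.
    by apply; rewrite ltrDr.
  (* This radius makes |s| n kappa at most 1/2; the added 1 keeps the denominator positive. *)
  have e0 : 0 < (2 * (n%:R * kappa + 1))^-1 :> R.
    by rewrite invr_gt0 mulr_gt0// ltr_wpDl// mulr_ge0.
  near=> s.
  have ns : `|s| <= (2 * (n%:R * kappa + 1))^-1.
    by near: s; exact: near0_norm_le e0.
  have nGs : forall A, `|G A s| <= 1 + `|G A 0| by near: s.
  have S0 : 0 <= S s by apply: sumr_ge0.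
  have SG : S s <= \sum_A (1 + `|G A 0|) + `|s| * (n%:R * kappa) * S s.
    have -> : `|s| * (n%:R * kappa) * S s = \sum_(A < n) `|s| * (kappa * S s).
      by rewrite sumr_const card_ord -mulr_natl; ring.
    rewrite -big_split /=; apply: ler_sum => A _; rewrite FE.
    apply: (le_trans (ler_normB _ _)); apply: lerD => //.
    by rewrite normrM ler_wpM2l.
  have skap : `|s| * (n%:R * kappa) <= 2^-1.
    have nk0 : 0 <= n%:R * kappa by rewrite mulr_ge0.
    apply: (@le_trans _ _ ((2 * (n%:R * kappa + 1))^-1 * (n%:R * kappa))).
      exact: ler_wpM2r.
    rewrite mulrC ler_pdivrMr ?mulr_gt0 ?ltr_wpDl//; lra.
  have : `|s| * (n%:R * kappa) * S s <= 2^-1 * S s by apply: ler_wpM2r.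
  by rewrite /M; lra.
have cF A : {for 0, continuous (F A)}.
  have -> : F A = G A \- (fun s => s * \sum_C K C A * F C s).
    by apply/funext => s; rewrite /= -FE.
  apply: continuousB; first exact: cG.
  suff : (fun s => s * \sum_C K C A * F C s) x @[x --> (0 : R)] --> (0 : R).
    by rewrite /prop_for /continuous_at /= mul0r.
  apply/cvgr0Pnorm_le => e e0.
  have M1 : 0 < kappa * `|M| + 1 by rewrite ltr_wpDl// mulr_ge0.
  near=> s.
  have sM : S s <= `|M|.
    by apply: (@le_trans _ _ M); [near: s|exact: ler_norm].
  have ns : `|s| <= e / (kappa * `|M| + 1).
    by near: s; apply: near0_norm_le; rewrite divr_gt0.
  rewrite normrM; apply: (@le_trans _ _ (e / (kappa * `|M| + 1) * (kappa * `|M| + 1))).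
    apply: ler_pM => //; apply: (le_trans (sumKF _ _)).
    by rewrite ler_wpDr// ler_wpM2l.
  by rewrite divfK// gt_eqF.
(* Both terms are now differentiable at 0: [G A] by hypothesis, the product because its second
   factor is continuous. *)
move=> A; have -> : F A = G A - (fun s => s * \sum_C K C A * F C s).
  by apply/funext => s; rewrite fctE /= -FE.
apply: is_deriveB.
apply: (@is_derive0_idM _ (fun s => \sum_C K C A * F C s)).
have -> : (fun s => \sum_C K C A * F C s) = \sum_C (fun s => K C A * F C s).
  by apply/funext => s; rewrite fct_sumE.
apply: (big_ind (fun f : R -> R => {for 0, continuous f})).
- exact: cst_continuous.
- by move=> f g; exact: continuousD.
- by move=> C _; apply: continuousM; [exact: cst_continuous|exact: cF].
Unshelve. all: by end_near.
Qed.

(** * Transformation of the twisting vector *)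

Lemma sum_delta (R : pzRingType) n (b : 'I_n) (f : 'I_n -> R) :
  \sum_a (a == b)%:R * f a = f b.
Proof.
rewrite (bigD1 b)//= big1 ?addr0 ?eqxx ?mul1r// => a /negPf ->.
by rewrite mul0r.
Qed.

(** Each of the four terms of f contracts to a product of [T] and [X]; antisymmetry of the lowered
    [X] makes them agree in pairs, which gives the factor 2. *)
Lemma f_mixed_contraction (R : realType) n (alpha : R) (eps : 'rV[R]_n)
    (T : 'I_n -> 'I_n -> R) (X : 'M[R]_n) A B :
  (forall k, eps 0 k * eps 0 k = 1) -> in_so (diag_mx eps) X ->
  \sum_E \sum_F \sum_M \sum_K
     f_mixed alpha (diag_mx eps) E F A B M K * T E F * raise (diag_mx eps) X M K
  = 2 * alpha * (\sum_M T B M * X M A - \sum_M T A M * X M B).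
Proof.
move=> eps2 soX.
have raiseE M K : raise (diag_mx eps) X M K = X M K * eps 0 K.
  by rewrite /raise invmx_diag_sign// mul_mx_diag mxE.
(* Lowering the first index of Theta^{MK} gives - Theta^K_M by antisymmetry, while lowering the
   second recovers Theta^M_K. *)
have raiseN M K : eps 0 M * raise (diag_mx eps) X M K = - X K M.
  have := congr1 (fun Z : 'M[R]_n => Z K M) soX => E; rewrite mxE mul_diag_mx !mxE in E.
  by rewrite raiseE mulrA E mulNr mulrAC eps2 mul1r.
have raiseN' M K : eps 0 K * raise (diag_mx eps) X M K = X M K.
  by rewrite raiseE mulrCA eps2 mulr1.
under eq_bigr => E _ do rewrite exchange_big /=.
rewrite exchange_big /=.
transitivity (\sum_M \sum_K alpha * (
    (M == B)%:R * (T A K * (- X K B)) - (M == A)%:R * (T B K * (- X K A))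
    - (K == B)%:R * (T A M * X M B) + (K == A)%:R * (T B M * X M A))).
  apply: eq_bigr => M _.
  under eq_bigr => E _ do rewrite exchange_big /=.
  rewrite exchange_big /=; apply: eq_bigr => K _.
  set gX := fun C C' => alpha * (diag_mx eps C C' * raise (diag_mx eps) X M K).
  transitivity (\sum_E \sum_F
      (((E == A)%:R * ((F == K)%:R * (T E F * gX B M))
       - (E == B)%:R * ((F == K)%:R * (T E F * gX A M)))
       - ((E == A)%:R * ((F == M)%:R * (T E F * gX B K))
       - (E == B)%:R * ((F == M)%:R * (T E F * gX A K))))).
    apply: eq_bigr => E _; apply: eq_bigr => F _.
    by rewrite /f_mixed /asym /gX; field.
  under eq_bigr => E _ do rewrite !sumrB -!mulr_sumr !sum_delta.
  rewrite !sumrB !sum_delta /gX !diag_mxE.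
  rewrite ![_ * _%:R * raise _ _ _ _]mulrAC !raiseN !raiseN' !(eq_sym A) !(eq_sym B).
  have XM C : X K M * (M == C)%:R = X K C * (M == C)%:R.
    by case: eqP => [->|_]; rewrite ?mulr0.
  have XK C : X M K * (K == C)%:R = X M C * (K == C)%:R.
    by case: eqP => [->|_]; rewrite ?mulr0.
  by rewrite !mulNr !XM !XK; ring.
under [LHS]eq_bigr => M _ do
  rewrite -mulr_sumr big_split !sumrB /= -!mulr_sumr !sum_delta.
rewrite -mulr_sumr big_split !sumrB /= !sum_delta.
have sN C C' : \sum_K T C K * (- X K C') = - \sum_K T C K * X K C'.
  by rewrite -sumrN; apply: eq_bigr => K _; rewrite mulrN.
by rewrite !sN; ring.
Qed.

(** The domain is a general normed space because this product rule serves twice: along x^i for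
    antisymmetry of the twisting vector, and in the parameter s for its variation. *)
Lemma is_derive_dot (R : realType) (V : normedModType R) m (G : 'M[R]_m)
    (u v : 'I_m -> V -> R) (du dv : 'I_m -> R) (x w : V) :
  (forall k, is_derive x w (u k) (du k)) ->
  (forall k, is_derive x w (v k) (dv k)) ->
  is_derive x w (fun y => dot G (u^~ y) (v^~ y))
    (dot G du (v^~ x) + dot G (u^~ x) dv).
Proof.
move=> hu hv.
have -> : (fun y => dot G (u^~ y) (v^~ y)) =
    \sum_k \sum_l (u k * v l * cst (G k l)).
  apply/funext => y; rewrite fct_sumE; apply: eq_bigr => k _.
  by rewrite fct_sumE; apply: eq_bigr.
apply: is_derive_eq.
rewrite /dot -big_split; apply: eq_bigr => k _.
rewrite -big_split; apply: eq_bigr => l _ /=.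
rewrite scaler0 add0r  ?fctE /GRing.scale /=; ring.
Qed.

Lemma dotC (R : realType) m (d : 'rV[R]_m) (u v : 'I_m -> R) :
  dot (diag_mx d) u v = dot (diag_mx d) v u.
Proof.
rewrite /dot exchange_big /=; apply: eq_bigr => l _; apply: eq_bigr => k _.
by rewrite !mxE [l == k]eq_sym; case: eqP => [->|_] /=; ring.
Qed.

Lemma dot_suml (R : realType) m n (G : 'M[R]_m) (k : 'I_n -> R)
    (u : 'I_n -> 'I_m -> R) (v : 'I_m -> R) :
  dot G (fun mu => \sum_C k C * u C mu) v = \sum_C k C * dot G (u C) v.
Proof.
rewrite /dot; under [RHS]eq_bigr => C _ do rewrite mulr_sumr.
rewrite [RHS]exchange_big /=; apply: eq_bigr => mu _.
under [RHS]eq_bigr => C _ do rewrite mulr_sumr.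
rewrite [RHS]exchange_big /=; apply: eq_bigr => nu _.
rewrite !mulr_suml; apply: eq_bigr => C _; ring.
Qed.

Lemma dot_sumr (R : realType) m n (G : 'M[R]_m) (k : 'I_n -> R)
    (u : 'I_m -> R) (v : 'I_n -> 'I_m -> R) :
  dot G u (fun mu => \sum_C k C * v C mu) = \sum_C k C * dot G u (v C).
Proof.
rewrite /dot; under [RHS]eq_bigr => C _ do rewrite mulr_sumr.
rewrite [RHS]exchange_big /=; apply: eq_bigr => mu _.
under [RHS]eq_bigr => C _ do rewrite mulr_sumr.
rewrite [RHS]exchange_big /=; apply: eq_bigr => nu _.
rewrite mulr_sumr mulr_suml; apply: eq_bigr => C _; ring.
Qed.

Lemma dotNl (R : realType) m (G : 'M[R]_m) (u v : 'I_m -> R) :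
  dot G (fun mu => - u mu) v = - dot G u v.
Proof.
rewrite /dot -sumrN; apply: eq_bigr => mu _; rewrite -sumrN.
by apply: eq_bigr => nu _; ring.
Qed.

Lemma dotBr (R : realType) m (G : 'M[R]_m) (u v w : 'I_m -> R) :
  dot G u (fun mu => v mu - w mu) = dot G u v - dot G u w.
Proof.
rewrite /dot -sumrB; apply: eq_bigr => mu _; rewrite -sumrB.
by apply: eq_bigr => nu _; ring.
Qed.

Lemma dotNr (R : realType) m (G : 'M[R]_m) (u v : 'I_m -> R) :
  dot G u (fun mu => - v mu) = - dot G u v.
Proof.
rewrite /dot -sumrN; apply: eq_bigr => mu _; rewrite -sumrN.
by apply: eq_bigr => nu _; ring.
Qed.

(** The products of normal vectors are constant on [U], which is open, so their partial derivatives
    vanish; the product rule then gives the antisymmetry. *)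
Lemma twisting_antisym (R : realType) D n (U : set 'rV[R]_4) (d : 'rV[R]_D)
    (Y : embedding R D) (gN : 'M[R]_n) (N : frame R D n) i A B x :
  open U -> U x -> orthonormal_normal_frame U (diag_mx d) Y gN N ->
  twisting (diag_mx d) N i A B x = - twisting (diag_mx d) N i B A x.
Proof.
move=> oU Ux hN; have [dN _ _] := hN x Ux.
have dNi C mu : is_derive x (delta_mx 0 i : 'rV[R]_4) (N C mu) (partial i (N C mu) x).
  by apply: derivableP; exact: diff_derivable.
have := is_derive_dot (diag_mx d) (dNi B) (dNi A) => H.
have : 'D_(delta_mx 0 i) (fun y => dot (diag_mx d) ((N B)^~ y) ((N A)^~ y)) x = 0.
  rewrite -(derive_cst (gN B A) x (delta_mx 0 i : 'rV[R]_4)).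
  apply: near_eq_derive; near=> y.
  have Uy : U y by near: y; exact: open_nbhs_nbhs.
  by have [_ _ ->] := hN y Uy.
rewrite derive_val => /eqP; rewrite addrC addr_eq0 => /eqP E.
by rewrite {2}/twisting E opprK dotC.
Unshelve. all: by end_near.
Qed.

(** * First-order behaviour of rotated frames *)

Lemma displacement_delta (R : realType) D n (N : frame R D n) A mu x :
  displacement N (fun _ B => (B == A)%:R) mu x = N A mu x.
Proof. exact: (sum_delta A (fun B => N B mu x)). Qed.

(** Testing with x^B = delta^B_A extracts from the relation between displacements one implicit
    equation for each normal vector. *)
Lemma displacement_rotate_delta (R : realType) D n (N : frame R D n)
    (Theta : 'rV[R]_4 -> 'M[R]_n) (s : R) A mu x :
  displacement N (fun y => rotate (s *: Theta y) (fun B => (B == A)%:R)) mu x =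
  N A mu x + s * \sum_C Theta x C A * N C mu x.
Proof.
rewrite -displacement_delta /displacement mulr_sumr -big_split /=.
apply: eq_bigr => C _; rewrite /rotate mulrDl; congr (_ + _).
rewrite (eq_bigr (fun M => (M == A)%:R * (s * Theta x C M))); last first.
  by move=> M _; rewrite mxE mulrC.
by rewrite sum_delta mulrA.
Qed.

(** [is_derive0_implicit] is applied first to the values of [N'], then to their partial derivatives,
    whose equation has a source term containing the derivative of [Theta] and the values already
    treated. *)
Lemma rotated_frame_first_order (R : realType) D n (U : set 'rV[R]_4)
    (N : frame R D n) (Theta : 'rV[R]_4 -> 'M[R]_n) (N' : R -> frame R D n) x i :
  U x -> (forall A M, differentiable (fun y => Theta y A M) x) ->
  rotated_frame U N Theta N' -> forall A mu,
  [/\ N' 0 A mu x = N A mu x,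
      partial i (N' 0 A mu) x = partial i (N A mu) x,
      is_derive (0 : R) (1 : R) (fun s => N' s A mu x)
        (- \sum_C Theta x C A * N C mu x)
    & is_derive (0 : R) (1 : R) (fun s => partial i (N' s A mu) x)
        (- \sum_C partial i (fun y => Theta y C A) x * N C mu x
         - \sum_C Theta x C A * partial i (N C mu) x)].
Proof.
move=> Ux dT [dN' Heq] A mu; move: A.
have dN'x := dN' x Ux.
have disp A : displacement N (fun=> (fun B => (B == A)%:R)) mu = N A mu.
  by apply/funext => y; exact: displacement_delta.
have E1 A : N' 0 A mu x = N A mu x /\
    is_derive (0 : R) (1 : R)
      (fun s => N' s A mu x + s * \sum_C Theta x C A * N' s C mu x) 0.
  have [/littleo_id_is_derive[e0 de] _] := Heq (fun B => (B == A)%:R) mu x Ux.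
  rewrite disp displacement_rotate_delta mul0r addr0 in e0.
  split; first by apply/eqP; rewrite eq_sym -subr_eq0 e0.
  have -> : (fun s => N' s A mu x + s * \sum_C Theta x C A * N' s C mu x) =
      cst (N A mu x) - (fun s => displacement N (fun=> (fun B => (B == A)%:R)) mu x -
        displacement (N' s)
          (fun x => rotate (s *: Theta x) (fun B => (B == A)%:R)) mu x).
    apply/funext => s; rewrite !fctE disp displacement_rotate_delta; ring.
  by apply: is_derive_eq; rewrite subr0.
have dw A : is_derive (0 : R) (1 : R) (fun s => N' s A mu x)
    (- \sum_C Theta x C A * N C mu x).
  have := is_derive0_implicit (fun A => (E1 A).2) A.
  rewrite sub0r; under eq_bigr => C _ do rewrite (E1 C).1.
  exact.
(* The product rule is available only for s near 0, where [N' s] is differentiable at x. *)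
have E2 A : \forall s \near (0 : R),
    partial i (displacement (N' s)
      (fun y => rotate (s *: Theta y) (fun B => (B == A)%:R)) mu) x
    = partial i (N' s A mu) x
      + s * (\sum_C partial i (fun y => Theta y C A) x * N' s C mu x
             + \sum_C Theta x C A * partial i (N' s C mu) x).
  apply: filterS dN'x => s dNs.
  have dNi C : is_derive x (delta_mx 0 i : 'rV[R]_4) (N' s C mu)
      (partial i (N' s C mu) x).
    by apply: derivableP; exact: diff_derivable.
  have dTi C : is_derive x (delta_mx 0 i : 'rV[R]_4) (fun y => Theta y C A)
      (partial i (fun y => Theta y C A) x).
    by apply: derivableP; exact: diff_derivable.
  have -> : displacement (N' s)
        (fun y => rotate (s *: Theta y) (fun B => (B == A)%:R)) mu
      = N' s A mu + s \*: \sum_C ((fun y => Theta y C A) * N' s C mu).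
    apply/funext => y; rewrite displacement_rotate_delta !fctE.
    by congr (_ + s * _); rewrite fct_sumE.
  rewrite {1}/partial derive_val; congr (_ + s * _).
  rewrite -big_split; apply: eq_bigr => C _ /=.
  by rewrite addrC; congr (_ + _); exact: mulrC.
have E3 A : partial i (N' 0 A mu) x = partial i (N A mu) x /\
    is_derive (0 : R) (1 : R)
      (fun s => partial i (N' s A mu) x
                + s * \sum_C Theta x C A * partial i (N' s C mu) x)
      (- \sum_C partial i (fun y => Theta y C A) x * N C mu x).
  have [_ /(_ i) /littleo_id_is_derive[e0 de]] := Heq (fun B => (B == A)%:R) mu x Ux.
  have /nbhs_singleton E20 := E2 A.
  rewrite disp E20 mul0r addr0 in e0.
  split; first by apply/eqP; rewrite eq_sym -subr_eq0 e0.
  (* [Q] is the source term; moved to the known side, s Q(s) contributes Q(0) to the derivative. *)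
  pose Q s := \sum_C partial i (fun y => Theta y C A) x * N' s C mu x.
  have dQ : is_derive (0 : R) (1 : R) (fun s => s * Q s) (Q 0).
    apply: is_derive0_idM.
    have -> : Q = \sum_C (partial i (fun y => Theta y C A) x \*:
        (fun s => N' s C mu x)).
      by apply/funext => s; rewrite fct_sumE.
    exact: is_derive0_continuous (is_derive_sum (fun C =>
      is_deriveZ (partial i (fun y => Theta y C A) x) (dw C))).
  have -> : - \sum_C partial i (fun y => Theta y C A) x * N C mu x = 0 - 0 - Q 0.
    by rewrite subr0 sub0r; congr (- _); apply: eq_bigr => C _; rewrite (E1 C).1.
  apply: (near_eq_is_derive _ (is_deriveB
    (is_deriveB (is_derive_cst (partial i (N A mu) x) _ _) de) dQ)).
  apply: filterS (E2 A) => s E2s.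
  by rewrite !fctE disp E2s /Q; ring.
move=> A; split; [exact: (E1 A).1|exact: (E3 A).1|exact: dw|].
have <- : \sum_C Theta x C A * partial i (N' 0 C mu) x =
    \sum_C Theta x C A * partial i (N C mu) x.
  by apply: eq_bigr => C _; rewrite (E3 C).1.
exact: is_derive0_implicit (fun A => (E3 A).2) A.
Qed.

(** * Gram matrices and the signature of the normal vectors *)

Lemma mulmx_dot (R : realType) m n k (G : 'M[R]_m) (A : 'M[R]_(n, m))
    (B : 'M[R]_(k, m)) a b :
  (A *m G *m B^T) a b = dot G (A a) (B b).
Proof.
rewrite mxE /dot exchange_big /=; apply: eq_bigr => nu _.
rewrite !mxE mulr_suml; apply: eq_bigr => mu _; ring.
Qed.

Lemma normal_signature (R : realType) p q (U : set 'rV[R]_4)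
    (g : 'rV[R]_4 -> 'M[R]_4) (d : 'rV[R]_(p + q)) (eps : 'rV[R]_(p + q - 4))
    (Y : embedding R (p + q)) (N : frame R (p + q) (p + q - 4)) x :
  (3 <= p)%N -> (1 <= q)%N -> U x -> sign_vector d p q ->
  has_signature (g x) 3 1 -> isometric_embedding U (diag_mx d) g Y ->
  (forall A, eps 0 A = 1 \/ eps 0 A = -1) ->
  orthonormal_normal_frame U (diag_mx d) Y (diag_mx eps) N ->
  sign_vector eps (p - 3) (q - 1).
Proof.
move=> hp hq Ux hd [P [f [_ hf Pg]]] /(_ x Ux)[_ gE] heps /(_ x Ux)[_ NY NN].
pose J : 'M[R]_(4, p + q) := \matrix_(i, mu) partial i (Y mu) x.
pose K : 'M[R]_(p + q - 4, p + q) := \matrix_(A, mu) N A mu x.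
have JE i : J i = fun mu => partial i (Y mu) x by apply/funext => mu; rewrite mxE.
have KE A : K A = fun mu => N A mu x by apply/funext => mu; rewrite mxE.
have JJ : J *m diag_mx d *m J^T = g x.
  by apply/matrixP => i j; rewrite mulmx_dot !JE gE.
have KJ : K *m diag_mx d *m J^T = 0.
  by apply/matrixP => A j; rewrite mulmx_dot KE JE NY mxE.
have JK : J *m diag_mx d *m K^T = 0.
  by apply/matrixP => j A; rewrite mulmx_dot KE JE dotC NY mxE.
have KK : K *m diag_mx d *m K^T = diag_mx eps.
  by apply/matrixP => A B; rewrite mulmx_dot !KE NN.
(* The diagonalized tangent vectors are stacked on the normal ones; normality annihilates the mixed
   blocks of the Gram matrix, leaving the diagonal of [f] and [eps]. *)
apply: (@complement_signature _ _ _ d eps f (col_mx (P^T *m J) K)) => //.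
rewrite mul_col_mx tr_col_mx mul_col_row diag_mx_row KK trmx_mul trmxK.
have -> : K *m diag_mx d *m (J^T *m P) = 0 by rewrite mulmxA KJ mul0mx.
have -> : P^T *m J *m diag_mx d *m K^T = 0 by rewrite -!mulmxA (mulmxA J) JK mulmx0.
by rewrite -Pg -JJ !mulmxA.
Qed.

(** * Variation of the twisting vector *)

Lemma twisting_transformation (R : realType) D n (U : set 'rV[R]_4)
    (d : 'rV[R]_D) (eps : 'rV[R]_n) (Y : embedding R D) (N : frame R D n)
    (Theta : 'rV[R]_4 -> 'M[R]_n) (N' : R -> frame R D n) x i A B :
  open U -> U x -> (forall A, eps 0 A * eps 0 A = 1) ->
  orthonormal_normal_frame U (diag_mx d) Y (diag_mx eps) N ->
  rotation_parameter U (diag_mx eps) Theta -> rotated_frame U N Theta N' ->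
  (fun s => twisting (diag_mx d) (N' s) i A B x -
     (twisting (diag_mx d) N i A B x
      - \sum_E \sum_F \sum_M \sum_K
          f_mixed (- 2^-1) (diag_mx eps) E F A B M K * twisting (diag_mx d) N i E F x
          * raise (diag_mx eps) (s *: Theta x) M K
      - partial i (fun y => lower (diag_mx eps) (s *: Theta y) A B) x))
  =o_ (0 : R) id.
Proof.
move=> oU Ux eps2 hN hT hN'; have [soT dT] := hT x Ux.
have W := rotated_frame_first_order i Ux dT hN'.
set T := fun A B => twisting (diag_mx d) N i A B x.
set dTh := fun C => partial i (fun y => Theta y C B) x.
(* The claimed right-hand side equals A_{iAB} - s [q], so it remains to show that A' has value
   A_{iAB} and derivative [- q] at s = 0. *)
pose q := \sum_M Theta x M A * T M B + \sum_M Theta x M B * T A M + eps 0 A * dTh A.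
have lowerE s : partial i (fun y => lower (diag_mx eps) (s *: Theta y) A B) x =
    s * (eps 0 A * dTh A).
  have -> : (fun y => lower (diag_mx eps) (s *: Theta y) A B) =
      (s * eps 0 A) \*: (fun y => Theta y A B).
    by apply/funext => y; rewrite /lower mul_diag_mx !mxE /= /GRing.scale /=; ring.
  rewrite /partial deriveZ; last exact: diff_derivable.
  by rewrite /GRing.scale /= mulrA.
have sumE s : \sum_E \sum_F \sum_M \sum_K
      f_mixed (- 2^-1) (diag_mx eps) E F A B M K * T E F
      * raise (diag_mx eps) (s *: Theta x) M K =
    s * (\sum_M Theta x M A * T M B + \sum_M Theta x M B * T A M).
  rewrite f_mixed_contraction//; last first.
    by rewrite /in_so -scalemxAr linearZ /= soT scalerN.
  rewrite mulrN divff ?pnatr_eq0// mulN1r opprB addrC mulrDr !mulr_sumr -sumrN.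
  congr (_ + _); apply: eq_bigr => M _; rewrite mxE; last by ring.
  (* Antisymmetry turns - A_{iBM} into A_{iMB}, the order in which the product rule produces it. *)
  by rewrite {1}/T (twisting_antisym _ _ _ oU Ux hN); rewrite -/(T _ _); ring.
have -> : (fun s => twisting (diag_mx d) (N' s) i A B x - (T A B
      - \sum_E \sum_F \sum_M \sum_K f_mixed (- 2^-1) (diag_mx eps) E F A B M K * T E F
          * raise (diag_mx eps) (s *: Theta x) M K
      - partial i (fun y => lower (diag_mx eps) (s *: Theta y) A B) x)) =
    (fun s => twisting (diag_mx d) (N' s) i A B x) - (cst (T A B) - (q \*: id)).
  by apply/funext => s; rewrite sumE lowerE !fctE /q /= /GRing.scale /=; ring.
have T0 : twisting (diag_mx d) (N' 0) i A B x = T A B.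
  rewrite /T /twisting; congr (dot _ _ _); apply/funext => mu.
    by have [] := W A mu.
  by have [] := W B mu.
apply/littleo_id_is_derive; split.
  by rewrite !fctE /= T0 scaler0 subr0 subrr.
have [_ _ NN] := hN x Ux.
have dTw : is_derive (0 : R) (1 : R)
    (fun s => twisting (diag_mx d) (N' s) i A B x) (- q).
  have dA mu : is_derive (0 : R) (1 : R) (fun s => N' s A mu x)
      (- \sum_C Theta x C A * N C mu x) by have [] := W A mu.
  have dB mu : is_derive (0 : R) (1 : R) (fun s => partial i (N' s B mu) x)
      (- \sum_C dTh C * N C mu x - \sum_C Theta x C B * partial i (N C mu) x).
    by have [] := W B mu.
  apply: is_derive_eq (is_derive_dot (diag_mx d) dA dB) _.
  have -> : (fun mu => N' 0 A mu x) = fun mu => N A mu x.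
    by apply/funext => mu; have [] := W A mu.
  have -> : (fun mu => partial i (N' 0 B mu) x) = fun mu => partial i (N B mu) x.
    by apply/funext => mu; have [] := W B mu.
  rewrite dotNl dotBr dotNr (dot_suml _ _ (fun C mu => N C mu x)).
  rewrite (dot_sumr _ _ _ (fun C mu => N C mu x)).
  rewrite (dot_sumr _ _ _ (fun C mu => partial i (N C mu) x)).
  (* Orthonormality leaves only C = A, and the sign of A lowers the index: this is Theta_{AB,i}. *)
  have -> : \sum_C dTh C * dot (diag_mx d) ((N A)^~ x) (fun mu => N C mu x) =
      eps 0 A * dTh A.
    rewrite -(sum_delta A (fun C => eps 0 C * dTh C)).
    by apply: eq_bigr => C _; rewrite NN diag_mxE eq_sym; ring.
  by rewrite /q /T /twisting; ring.
apply: is_derive_eq.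
by rewrite /GRing.scale /= mulr1; ring.
Qed.

Theorem theorem2 (R : realType) (p q : nat) (hp : (3 <= p)%N) (hq : (1 <= q)%N) :
  exists alpha : R, alpha != 0 /\
  forall (U : set 'rV[R]_4) (g : 'rV[R]_4 -> 'M[R]_4)
    (d : 'rV[R]_(p + q)) (eps : 'rV[R]_(p + q - 4))
    (Y : embedding R (p + q)) (N : frame R (p + q) (p + q - 4)),
  let eta := diag_mx d in
  let gN := diag_mx eps in
  open U -> U !=set0 ->
  sign_vector d p q ->
  (forall x, U x -> has_signature (g x) 3 1) ->
  isometric_embedding U eta g Y ->
  (forall A, eps 0 A = 1 \/ eps 0 A = -1) ->
  orthonormal_normal_frame U eta Y gN N ->
  [/\ sign_vector eps (p - 3) (q - 1),
      so_structure_constants alpha gN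
    & forall (Theta : 'rV[R]_4 -> 'M[R]_(p + q - 4))
        (N' : R -> frame R (p + q) (p + q - 4)),
      rotation_parameter U gN Theta ->
      rotated_frame U N Theta N' ->
      forall (x : 'rV[R]_4) (i : 'I_4) (A B : 'I_(p + q - 4)), U x ->
      (fun s => twisting eta (N' s) i A B x -
         (twisting eta N i A B x
          - \sum_E \sum_F \sum_M \sum_K
              f_mixed alpha gN E F A B M K * twisting eta N i E F x
              * raise gN (s *: Theta x) M K
          - partial i (fun y => lower gN (s *: Theta y) A B) x))
      =o_ (0 : R) id].
Proof.
(* The contraction carries the factor 2 alpha, which must be -1. *)
exists (- 2^-1); split; first by rewrite oppr_eq0 invr_eq0 pnatr_eq0.
move=> U g d eps Y N eta gN oU [x0 Ux0] hd hg hY heps hN.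
have eps2 A : eps 0 A * eps 0 A = 1 by case: (heps A) => ->; rewrite ?mulrNN mulr1.
split.
(* The signs [eps] do not depend on the point, so the signature can be read off at the single point
   [x0]. *)
- exact: (normal_signature hp hq Ux0 hd (hg _ Ux0) hY heps hN).
- by apply: so_structure_constants_diag => //; rewrite oppr_eq0 invr_eq0 pnatr_eq0.
- move=> Theta N' hT hN' x i A B Ux.
  exact: (twisting_transformation i A B oU Ux eps2 hN hT hN').
Qed.
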